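(* Let $D_{G'}$ be the formal derivative with $D_{G'}(x)=y$, $D_{G'}(y)=y$. For any $n\ge 1$, the following identity of operators holds: $$(xD_{G'})^n=\sum_{k=1}^n\sum_{\ell=k}^n A_{n,k,\ell}\,x^\ell y^{n-\ell}D_{G'}^k,$$ where the coefficients $A_{n,k,\ell}$ satisfy the recurrence relation $$A_{n+1,k,\ell}=\ell A_{n,k,\ell}+(n-\ell+1)A_{n,k,\ell-1}+A_{n,k-1,\ell-1},$$ with the initial conditions $A_{1,1,1}=1$ and $A_{1,k,\ell}=0$ if $(k,\ell)\ne(1,1)$. Moreover, $A_{n,k,\ell}$ counts the binary $k$-forests on $[n]$ with $n-\ell$ right leaves.
   Context: $D_{G'}$ is the linear operator on polynomials in the commuting indeterminates $x,y$ satisfying the Leibniz rule $D_{G'}(uv)=D_{G'}(u)v+uD_{G'}(v)$ with the given values on $x,y$; $xD_{G'}$ is the operator $f\mapsto x\cdot D_{G'}(f)$. The coefficients $A_{n,k,\ell}$ are taken to be $0$ outside $1\le k\le\ell\le n$. A planted binary increasing plane tree on a finite set $S$ of $m\ge1$ positive integers is a plane tree with $m$ internal vertices, labelled bijectively by $S$, and $m$ unlabelled leaves, such that: (i) the root is an internal vertex, carries the smallest label, and has exactly one child; (ii) every other internal vertex has exactly two ordered children, a left child and a right child; (iii) the labels of the internal vertices along the path from the root to any internal vertex form an increasing sequence. A right leaf is a leaf that is the right child of an internal vertex (the single child of a root is not a right child). A binary $k$-forest on $[n]=\{1,\dots,n\}$ is a sequence of $k$ planted binary increasing plane trees whose label sets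 form a partition of $[n]$, with root labels increasing from left to right. The number of right leaves of a forest is the total over its trees. *)

(* Defs.v *)
From HB Require Import structures.
From mathcomp Require Import all_boot all_algebra.
From mathcomp Require Import mpoly.

Set Implicit Arguments.
Unset Strict Implicit.
Unset Printing Implicit Defensive.

Import GRing.Theory.
Local Open Scope ring_scope.

Definition varx (R : comNzRingType) : {mpoly R[2]} := 'X_(ord0 : 'I_2).
Definition vary (R : comNzRingType) : {mpoly R[2]} := 'X_(ord_max : 'I_2).

Definition is_DG' (R : comNzRingType)
    (D : {linear {mpoly R[2]} -> {mpoly R[2]}}) : Prop :=
  [/\ forall u v : {mpoly R[2]}, D (u * v) = D u * v + u * D v,
      D (varx R) = vary R
    & D (vary R) = vary R].

Lemma is_DG'_exists (R : comNzRingType) :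
  exists D : {linear {mpoly R[2]} -> {mpoly R[2]}}, is_DG' D.
Proof.
pose d (f : {mpoly R[2]}) : {mpoly R[2]} :=
  vary R * (f^`M(ord0 : 'I_2) + f^`M(ord_max : 'I_2)).
have dlin : linear d.
  move=> a u v; rewrite /d !mderivD !mderivZ addrACA -scalerDr mulrDr.
  by rewrite -scalerAr.
pose M := GRing.isLinear.Build R {mpoly R[2]} {mpoly R[2]} *:%R d dlin.
pose D : {linear {mpoly R[2]} -> {mpoly R[2]}} := HB.pack d M.
have dU (i j : 'I_2) : ('X_i : {mpoly R[2]})^`M(j) = (i == j)%:R.
  rewrite mderivX mnm1E; case: eqP => [->|_]; last by rewrite scale0r.
  have -> : (U_(j) - U_(j) = 0 :> 'X_{1..2})%MM.
    by apply/mnmP => k; rewrite mnmBE subnn mnm0E.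
  by rewrite scale1r mpolyX0.
exists D; split.
- move=> u v; rewrite /= /d !mderivM addrACA -mulrDl -(mulrDr u).
  by rewrite (mulrDr (vary R) (_ * v)) mulrA (mulrCA u).
- by rewrite /= /d /varx !dU /= addr0 mulr1.
- by rewrite /= /d /vary !dU /= add0r mulr1.
Qed.

Local Close Scope ring_scope.

(* The subtrees of a planted tree strictly below its root. *)
Inductive btree : Type :=
| Leaf
| Node of nat & btree & btree.

(* A root label together with the unique child of the root. *)
Record ptree : Type := PTree { root_label : nat; root_child : btree }.

Fixpoint blabels (t : btree) : seq nat :=
  if t is Node a l r then a :: blabels l ++ blabels r else [::].

Definition labels (T : ptree) : seq nat :=
  root_label T :: blabels (root_child T).

(* One label sequence per internal vertex: the one read on the path leading
   down to it. *)
Fixpoint bpaths (t : btree) : seq (seq nat) :=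
  if t is Node a l r then
    [:: a] :: [seq a :: p | p <- bpaths l ++ bpaths r]
  else [::].

Definition paths (T : ptree) : seq (seq nat) :=
  [:: root_label T] :: [seq root_label T :: p | p <- bpaths (root_child T)].

Definition is_leaf (t : btree) : bool := if t is Leaf then true else false.

Fixpoint bright_leaves (t : btree) : nat :=
  if t is Node _ l r then is_leaf r + bright_leaves l + bright_leaves r else 0.

Definition right_leaves (T : ptree) : nat := bright_leaves (root_child T).

(* Distinctness and positivity of the labels are imposed on whole forests,
   by the partition condition in [is_kforest]. *)
Definition increasing_ptree (T : ptree) : bool :=
  all (leq (root_label T)) (labels T) && all (sorted ltn) (paths T).

(* The [perm_eq] condition says that each element of {1, ..., n} labels
   exactly one internal vertex of the forest, and that there are no other
   labels. *)
Definition is_kforest (n k : nat) (F : seq ptree) : bool :=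
  [&& size F == k,
      all increasing_ptree F,
      perm_eq (flatten (map labels F)) (iota 1 n)
    & sorted ltn (map root_label F)].

Definition forest_right_leaves (F : seq ptree) : nat :=
  sumn (map right_leaves F).

Definition has_card (T : Type) (P : pred T) (m : nat) : Prop :=
  exists f : {t : T | P t} -> 'I_m, bijective f.

(* Main.v *)
Require Import Defs.
From HB Require Import structures.
From mathcomp Require Import all_boot all_algebra.
From mathcomp Require Import mpoly zify.

Import GRing.Theory.
Local Open Scope nat_scope.

(** Both sides of the theorem are governed by one growth process on trees.

    A forest is a single binary tree in disguise: each root keeps its child as
    its left subtree, and the right spine lists the roots. The increasing
    conditions on the trees of the forest together with the increasing order of
    the roots then amount to the heap condition on this one tree
    ([heap_tree_of_forest]). The trees of the forest become the nodes of the
    right spine, and its right leaves become the right leaves of the tree other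
    than the leaf that ends the spine.

    In an increasing tree labelled by {1, ..., n+1} the node n+1 has two leaves
    as children, so the tree arises in exactly one way from an increasing tree
    labelled by {1, ..., n}, by putting n+1 in place of a leaf
    ([mem_increasing_trees], [uniq_increasing_trees]). Suppose that the smaller
    tree has spine length k, l left leaves and r right leaves besides the end
    of the spine. Growing at the end of the spine gives (k+1, l+1, r); growing
    at each of the l left leaves gives (k, l, r+1); growing at each of the r
    other right leaves gives (k, l+1, r). This is [sum_insertions].

    Read in the natural numbers, this is the recurrence for the coefficients
    ([forest_count_rec]). Read in the polynomials, it is the Leibniz rule,
    with the tree standing for the term x^l y^r D^k f:
    x D (x^l y^r D^k f)
      = x^(l+1) y^r D^(k+1) f + l x^l y^(r+1) D^k f + r x^(l+1) y^r D^k f.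
    So (x D)^n f is the sum of these terms over all increasing trees on n
    labels ([iter_xD]), and collecting the equal terms gives the expansion;
    the exponent of y is n - l because l + r = n ([left_right_leaves]). *)

(** * Increasing binary trees and their growth *)

Lemma btree_eq_dec (t u : btree) : {t = u} + {t <> u}.
Proof. by decide equality; apply: eq_comparable. Qed.

HB.instance Definition _ := hasDecEq.Build btree (compareP btree_eq_dec).

Fixpoint spine (t : btree) : nat :=
  if t is Node _ _ r then (spine r).+1 else 0.

(** The tree reduced to a leaf counts no left leaf: that leaf is the end of the
    spine, where a new tree of the forest can start. *)
Fixpoint left_leaves (t : btree) : nat :=
  if t is Node _ l r then is_leaf l + left_leaves l + left_leaves r else 0.

(** Only the spine is followed here, and [bright_leaves] is used off it, so that
    the leaf ending the spine, which is no leaf of the forest, is left out. *)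
Fixpoint inner_right_leaves (t : btree) : nat :=
  if t is Node _ l r then bright_leaves l + inner_right_leaves r else 0.

Fixpoint heap (lo : nat) (t : btree) : bool :=
  if t is Node a l r then [&& lo < a, heap a l & heap a r] else true.

Fixpoint insertions (a : nat) (t : btree) : seq btree :=
  if t is Node b l r then
    [seq Node b l' r | l' <- insertions a l] ++
    [seq Node b l r' | r' <- insertions a r]
  else [:: Node a Leaf Leaf].

Fixpoint increasing_trees (n : nat) : seq btree :=
  if n is m.+1 then flatten [seq insertions n t | t <- increasing_trees m]
  else [:: Leaf].

(** It undoes any of the [insertions] of a new label [a], which shows that
    different trees never grow into the same tree. *)
Fixpoint prune (a : nat) (t : btree) : btree :=
  if t is Node b l r then
    if b == a then Leaf else Node b (prune a l) (prune a r)
  else Leaf.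

Lemma bright_leavesE t : bright_leaves t = ~~ is_leaf t + inner_right_leaves t.
Proof. by elim: t => //= b l _ r ->; case: r => //= *; lia. Qed.

(** A binary tree with n nodes has n + 1 leaves, and the end of the spine is on
    neither count. *)
Lemma left_right_leaves t :
  left_leaves t + inner_right_leaves t = size (blabels t).
Proof.
elim: t => //= b l IHl r IHr; rewrite size_cat -IHl -IHr bright_leavesE.
by case: (is_leaf l) => /=; lia.
Qed.

(** The left subtree of each spine node, or the leaf in its place, holds a
    leftmost leaf, which is a left leaf. *)
Lemma spine_le_left_leaves t : spine t <= left_leaves t.
Proof.
elim: t => //= b l IHl r IHr.
suff: 0 < is_leaf l + left_leaves l by lia.
by case: l IHl => //= c l' r'; lia.
Qed.

Lemma perm_insertions a t0 t :
  t \in insertions a t0 -> perm_eq (blabels t) (a :: blabels t0).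
Proof.
elim: t0 t => [|b l IHl r IHr] t /=; first by rewrite inE => /eqP ->.
rewrite mem_cat => /orP[] /mapP[u u_ins ->] /=.
  rewrite (perm_trans (y := b :: (a :: blabels l) ++ blabels r)) //.
    by rewrite perm_cons perm_cat2r IHl.
  exact: (permEl (perm_catCA [:: b] [:: a] _)).
rewrite (perm_trans (y := b :: blabels l ++ [:: a] ++ blabels r)) //.
  by rewrite perm_cons perm_cat2l IHr.
exact: (permEl (perm_catCA (b :: blabels l) [:: a] _)).
Qed.

Lemma heap_insertions a t0 t lo : lo < a -> all (gtn a) (blabels t0) ->
  t \in insertions a t0 -> heap lo t = heap lo t0.
Proof.
elim: t0 t lo => [|b l IHl r IHr] t lo lo_a /=.
  by rewrite inE => _ /eqP -> /=; rewrite lo_a.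
case/andP=> ba; rewrite all_cat => /andP[la ra].
rewrite mem_cat => /orP[] /mapP[u u_ins ->] /=.
  by rewrite (IHl u b ba la u_ins).
by rewrite (IHr u b ba ra u_ins).
Qed.

Lemma heap_labels lo t : heap lo t -> all (ltn lo) (blabels t).
Proof.
elim: t lo => //= b l IHl r IHr lo /and3P[lo_b /IHl hl /IHr hr].
have lt_lo: subpred (ltn b) (ltn lo) by move=> x; apply: ltn_trans lo_b.
by rewrite lo_b all_cat !(sub_all lt_lo).
Qed.

Lemma heap_max_leaf a t : heap a t -> all (geq a) (blabels t) -> t = Leaf.
Proof.
by case: t => //= b l r /and3P[ab _ _] /andP[/(leq_trans ab)]; rewrite ltnn.
Qed.

(** The maximal label can only sit on a node without inner children, and
    replacing this node by a leaf gives the tree that it was grown from. *)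
Lemma insertions_surj a t lo : heap lo t -> all (geq a) (blabels t) ->
  a \in blabels t -> exists t0, t \in insertions a t0.
Proof.
elim: t lo => //= b l IHl r IHr lo /and3P[_ hl hr].
rewrite all_cat inE mem_cat => /and3P[_ la ra] /or3P[/eqP eab|al|ar].
- subst b; exists Leaf.
  by rewrite (heap_max_leaf _ _ hl la) (heap_max_leaf _ _ hr ra) inE.
- have [l0 ins_l] := IHl _ hl la al; exists (Node b l0 r).
  by rewrite mem_cat map_f.
- have [r0 ins_r] := IHr _ hr ra ar; exists (Node b l r0).
  by rewrite mem_cat orbC map_f.
Qed.

Lemma prune_id a t : a \notin blabels t -> prune a t = t.
Proof.
elim: t => //= b l IHl r IHr; rewrite inE mem_cat !negb_or eq_sym.
by case/and3P=> /negPf-> /IHl-> /IHr->.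
Qed.

Lemma prune_insertions a t0 t : a \notin blabels t0 ->
  t \in insertions a t0 -> prune a t = t0.
Proof.
elim: t0 t => [|b l IHl r IHr] t /=.
  by rewrite inE => _ /eqP -> /=; rewrite eqxx.
rewrite inE mem_cat !negb_or eq_sym => /and3P[/negPf nb nl nr].
rewrite mem_cat => /orP[] /mapP[u u_ins ->] /=; rewrite nb.
  by rewrite (IHl u nl u_ins) (prune_id _ _ nr).
by rewrite (IHr u nr u_ins) (prune_id _ _ nl).
Qed.

Lemma uniq_insertions a t : uniq (insertions a t).
Proof.
elim: t => //= b l IHl r IHr; rewrite cat_uniq.
rewrite !map_inj_uniq => [|? ? []|? ? []] //.
rewrite IHl IHr andbT; apply/hasPn => _ /mapP[u u_ins ->].
apply/mapP=> -[v /perm_insertions/perm_size sv [ev _]].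
by rewrite -ev /= in sv; lia.
Qed.

(** Repeated growth reaches precisely the heap-ordered trees on {1, ..., n};
    the lower bound 0 in [heap] is harmless since labels are positive. *)
Lemma mem_increasing_trees n t :
  (t \in increasing_trees n) = heap 0 t && perm_eq (blabels t) (iota 1 n).
Proof.
elim: n t => [|n IHn] t /=.
  rewrite inE; case: t => [|a l r]; first by rewrite eqxx.
  by apply/eqP/andP => [//|[_ /perm_size]].
have iotaS : perm_eq (1 :: iota 2 n) (n.+1 :: iota 1 n).
  have := iotaD 1 n 1; rewrite addn1 add1n /= => ->.
  exact: (permEl (perm_catC (iota 1 n) [:: n.+1])).
rewrite (permPr iotaS).
have iota_lt m : m \in iota 1 n -> m < n.+1 by rewrite mem_iota => /andP[].
apply/flatten_mapP/andP.
  case=> t0; rewrite IHn => /andP[h0 p0] ins; split.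
    rewrite (@heap_insertions n.+1 t0) //.
    by rewrite (perm_all _ p0); apply/allP=> m /iota_lt.
  by rewrite (permPl (perm_insertions _ _ _ ins)) perm_cons.
case=> h p.
have [||t0 ins] := @insertions_surj n.+1 t 0 h.
- by rewrite (perm_all _ p) /= leqnn; apply/allP=> m /iota_lt/ltnW.
- by rewrite (perm_mem p) mem_head.
have p0 : perm_eq (blabels t0) (iota 1 n).
  by rewrite -(perm_cons n.+1) -(permPl (perm_insertions _ _ _ ins)).
exists t0; rewrite // IHn p0 andbT -(@heap_insertions n.+1 t0 t) //.
by rewrite (perm_all _ p0); apply/allP=> m /iota_lt.
Qed.

Lemma size_increasing_tree n t :
  t \in increasing_trees n -> size (blabels t) = n.
Proof.
by rewrite mem_increasing_trees => /andP[_ /perm_size->]; rewrite size_iota.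
Qed.

(** A retraction [g] tells from which element of [s] an entry of the
    concatenation comes, so blocks of different elements are disjoint. *)
Lemma uniq_flatten_map_retract (T U : eqType) (f : T -> seq U) (g : U -> T) s :
  uniq s -> {in s, forall x, uniq (f x)} ->
  {in s, forall x, {in f x, forall y, g y = x}} ->
  uniq (flatten (map f s)).
Proof.
elim: s => //= x s IHs /andP[xs us] uf gf.
rewrite cat_uniq uf ?mem_head // IHs // => [|y ys|y ys]; first last.
- by apply: gf; rewrite inE ys orbT.
- by apply: uf; rewrite inE ys orbT.
rewrite andbT; apply/hasPn => z /flatten_mapP[y ys yz].
apply: contraNN xs => xz.
by rewrite -(gf x (mem_head _ _) z xz) (gf y) // inE ys orbT.
Qed.

Lemma uniq_increasing_trees n : uniq (increasing_trees n).
Proof.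
elim: n => //= n IHn; apply: (@uniq_flatten_map_retract _ _ _ (prune n.+1)) => //.
  by move=> t _; apply: uniq_insertions.
move=> t t_n u; apply: prune_insertions.
move: t_n; rewrite mem_increasing_trees => /andP[_ /perm_mem->].
by rewrite mem_iota; lia.
Qed.

(** * The effect of growth on the statistics *)

(** The three terms are the growth at the end of the spine, at a left leaf, and
    at another right leaf. The summand is an arbitrary function with values in
    an arbitrary commutative monoid, so that the same count serves for natural
    numbers and for polynomials. *)
Lemma sum_insertions (V : nmodType) (G : nat -> nat -> nat -> V) a t :
  (\sum_(u <- insertions a t)
     G (spine u) (left_leaves u) (inner_right_leaves u)
   = G (spine t).+1 (left_leaves t).+1 (inner_right_leaves t)
     + G (spine t) (left_leaves t) (inner_right_leaves t).+1 *+ left_leaves t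
     + G (spine t) (left_leaves t).+1 (inner_right_leaves t)
         *+ inner_right_leaves t)%R.
Proof.
elim: t G => [|b l IHl r IHr] G /=.
  by rewrite big_seq1 /= !mulr0n !addr0.
rewrite big_cat !big_map /=.
set p := (is_leaf l + left_leaves l)%N; set q := bright_leaves l.
(* No new root arises in the left subtree: the end of its own spine is an
   ordinary right leaf, or the left leaf itself if the subtree is a leaf. Hence
   only the last two kinds of growth occur, with [p] and [q] places. *)
have -> : (\sum_(u <- insertions a l)
     G (spine r).+1 (is_leaf u + left_leaves u + left_leaves r)%N
       (bright_leaves u + inner_right_leaves r)%N
   = G (spine r).+1 (p + left_leaves r)%N (q + inner_right_leaves r).+1 *+ p
     + G (spine r).+1 (p + left_leaves r).+1 (q + inner_right_leaves r)%N *+ q)%R.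
  pose H i j := G (spine r).+1 (i + left_leaves r) (j + inner_right_leaves r).
  rewrite (eq_big_seq (fun u => H (left_leaves u) (inner_right_leaves u).+1)).
    rewrite (IHl (fun _ i j => H i j.+1)) /p /q /H bright_leavesE.
    case: (l) => [|c l1 l2] /=; first by rewrite !mulr0n !addr0.
    by rewrite !add0n !add1n !addSn mulrS [RHS]addrCA addrA.
  move=> u /perm_insertions/perm_size; rewrite bright_leavesE /H.
  by case: u.
rewrite (IHr (fun i j k => G i.+1 (p + j) (q + k))) !addnS.
by rewrite !mulrnDr addrACA; congr (_ + _)%R; apply: addrCA.
Qed.

Lemma big_insertions (V : nmodType) n (G : nat -> nat -> nat -> V) :
  (\sum_(u <- increasing_trees n.+1)
     G (spine u) (left_leaves u) (inner_right_leaves u)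
   = \sum_(t <- increasing_trees n)
       (G (spine t).+1 (left_leaves t).+1 (inner_right_leaves t)
       + G (spine t) (left_leaves t) (inner_right_leaves t).+1 *+ left_leaves t
       + G (spine t) (left_leaves t).+1 (inner_right_leaves t)
           *+ inner_right_leaves t))%R.
Proof.
rewrite /= big_flatten big_map; apply: eq_bigr => t _; exact: sum_insertions.
Qed.

(** * The coefficients *)

(** At n = 0 the empty forest is there to be counted, but the coefficients
    vanish outside 1 <= k <= l <= n; hence the exception. *)
Definition forest_count (n k l : nat) : nat :=
  if n is 0 then 0
  else count (fun t => (spine t == k) && (left_leaves t == l))
         (increasing_trees n).

Lemma increasing_tree_bounds n t : 0 < n -> t \in increasing_trees n ->
  [&& 1 <= spine t, spine t <= left_leaves t & left_leaves t <= n].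
Proof.
move=> n_gt0 /size_increasing_tree size_t.
rewrite spine_le_left_leaves -size_t -left_right_leaves leq_addr !andbT.
by case: t size_t => //= sz; rewrite -sz in n_gt0.
Qed.

Lemma forest_count_out n k l :
  ~~ [&& 1 <= k, k <= l & l <= n] -> forest_count n k l = 0.
Proof.
move=> out; rewrite /forest_count; case: n out => // n out.
apply/eqP; rewrite -leqn0 leqNgt -has_count; apply: contra out.
case/hasP=> t /increasing_tree_bounds bounds /andP[/eqP <- /eqP <-].
exact: bounds.
Qed.

Lemma forest_countE n k l : 0 < n ->
  forest_count n k l
  = \sum_(t <- increasing_trees n) ((spine t == k) && (left_leaves t == l)).
Proof. by case: n => // n _; rewrite -big_mkcond sum1_count. Qed.

Lemma forest_count_rec n k l : 0 < n -> 0 < k -> 0 < l ->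
  forest_count n.+1 k l =
    l * forest_count n k l + (n.+1 - l) * forest_count n k l.-1
    + forest_count n k.-1 l.-1.
Proof.
case: k l => [|k] [|l] // n_gt0 _ _; rewrite subSS !forest_countE //.
(* The third statistic is determined by the first two and [n], so [G] ignores
   it. *)
pose G i j (_ : nat) : nat := (i == k.+1) && (j == l.+1).
have mulrn_nat (x m : nat) : (x *+ m)%R = m * x.
  by elim: m => // m IHm; rewrite mulrS IHm mulSn.
transitivity (\sum_(t <- increasing_trees n)
  (left_leaves t * G (spine t) (left_leaves t) 0
   + inner_right_leaves t * G (spine t) (left_leaves t).+1 0
   + G (spine t).+1 (left_leaves t).+1 0)).
  transitivity (\sum_(u <- increasing_trees n.+1)
                  G (spine u) (left_leaves u) (inner_right_leaves u)) => //.
  rewrite (big_insertions nat n G); apply: eq_bigr => t _.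
  by rewrite -addrA addrC !mulrn_nat.
rewrite !big_distrr -!big_split; apply: eq_big_seq => t t_n.
have := left_right_leaves t; rewrite (size_increasing_tree _ _ t_n) => size_t.
rewrite /G /= !eqSS; congr (_ + _ + _).
  by case: andP => [[_ /eqP->]|]; rewrite ?muln0.
by case: andP => [[_ /eqP<-]|]; rewrite ?muln0 // -size_t addKn.
Qed.

(** * The operator identity *)

Section Operator.

Local Open Scope ring_scope.

(** The base of the induction, [D 1 = 0], is the Leibniz rule at 1 * 1. *)
Lemma derivation_exprn (R : comNzRingType) (D : R -> R) :
  (forall u v, D (u * v) = D u * v + u * D v) ->
  forall u n, D (u ^+ n) = u ^+ n.-1 * D u *+ n.
Proof.
move=> DM u; have D1 : D 1 = 0.
  by apply: (addrI (D 1)); rewrite addr0 -{3}(mulr1 1) DM mulr1 mul1r.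
elim=> [|n IHn]; first by rewrite D1 mulr0n.
rewrite exprS DM IHn mulrC mulrS; congr (_ + _).
by case: n {IHn} => [|n]; rewrite ?mulr0n ?mulr0 // exprS -mulrA mulrnAr.
Qed.

(** The step is the Leibniz rule: the three factors of the term of a tree give
    the three kinds of growth of that tree. *)
Lemma iter_xD (R : comNzRingType) (D : {linear {mpoly R[2]} -> {mpoly R[2]}}) :
  is_DG' D -> forall n f,
  iter n (fun g => varx R * D g) f
  = \sum_(t <- increasing_trees n)
      varx R ^+ left_leaves t * vary R ^+ inner_right_leaves t
      * iter (spine t) D f.
Proof.
case=> DM; set x := varx R; set y := vary R => Dx Dy n f.
elim: n => [|n IHn]; first by rewrite big_seq1 /= !mul1r.
rewrite (big_insertions _ n (fun k i j => x ^+ i * y ^+ j * iter k D f)).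
rewrite iterS {}IHn linear_sum mulr_sumr; apply: eq_bigr => t _ /=.
move: (left_leaves t) (inner_right_leaves t) (iter (spine t) D f) => i j g.
rewrite !DM !(derivation_exprn _ D DM) Dx Dy.
have -> : x ^+ i.-1 * y *+ i = x ^+ i.-1 *+ i * y by rewrite mulrnAl.
have -> : y ^+ j.-1 * y *+ j = y ^+ j *+ j.
  by case: j => // j; rewrite -exprSr.
have xi : x * (x ^+ i.-1 *+ i) = x ^+ i *+ i.
  by case: i => [|i]; rewrite ?mulr0 // mulrnAr -exprS.
rewrite !mulrDl !mulrDr !mulrA xi -exprS !exprS.
rewrite -[RHS]addrA [RHS]addrC.
by rewrite !(mulrnAl, mulrnAr) !mulrA.
Qed.

Lemma sum_by_statistics (V : nmodType) n (G : nat -> nat -> V) : (0 < n)%N ->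
  \sum_(t <- increasing_trees n) G (spine t) (left_leaves t)
  = \sum_(1 <= k < n.+1) \sum_(k <= l < n.+1) G k l *+ forest_count n k l.
Proof.
move=> n_gt0.
under [RHS]eq_bigr => k _.
  under eq_bigr => l _ do rewrite forest_countE // -sumrMnr.
  rewrite exchange_big.
over.
rewrite exchange_big; apply: eq_big_seq => t.
move=> /(increasing_tree_bounds _ _ n_gt0)/and3P[k_gt0 kl ln].
rewrite (bigD1_seq (spine t)) ?iota_uniq ?mem_index_iota //=; last by lia.
rewrite (bigD1_seq (left_leaves t)) ?iota_uniq ?mem_index_iota //=; last by lia.
rewrite !eqxx mulr1n !big1 ?addr0 // => [k|l] /negPf; rewrite eq_sym => ne.
  by rewrite big1 // => l _; rewrite ne.
by rewrite ne.
Qed.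

End Operator.

(** * Forests as trees *)

Lemma has_card_cancel (T : Type) (U : eqType) (P : pred T) (s : seq U)
    (f : T -> U) (g : U -> T) :
  cancel f g -> cancel g f -> uniq s -> (forall x, P x = (f x \in s)) ->
  has_card P (size s).
Proof.
move=> fK gK uniq_s Pf.
have index_lt (x : {x | P x}) : index (f (sval x)) s < size s.
  by rewrite index_mem -Pf (valP x).
have P_tnth i : P (g (tnth (in_tuple s) i)) by rewrite Pf gK mem_tnth.
exists (fun x => Ordinal (index_lt x)).
exists (fun i => exist (fun x => P x) _ (P_tnth i)) => [x|i].
  apply: val_inj; rewrite /= (tnth_nth (f (sval x))) /= nth_index ?fK //.
  by rewrite -Pf (valP x).
apply: val_inj; rewrite /= gK (tnth_nth (tnth (in_tuple s) i)) /=.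
by rewrite index_uniq.
Qed.

Fixpoint tree_of_forest (F : seq ptree) : btree :=
  if F is T :: F' then Node (root_label T) (root_child T) (tree_of_forest F')
  else Leaf.

Fixpoint forest_of_tree (t : btree) : seq ptree :=
  if t is Node a l r then PTree a l :: forest_of_tree r else [::].

Lemma tree_of_forestK : cancel tree_of_forest forest_of_tree.
Proof. by elim=> //= -[a l] F ->. Qed.

Lemma forest_of_treeK : cancel forest_of_tree tree_of_forest.
Proof. by elim=> //= a l _ r ->. Qed.

Lemma spine_tree_of_forest F : spine (tree_of_forest F) = size F.
Proof. by elim: F => //= T F ->. Qed.

Lemma blabels_tree_of_forest F :
  blabels (tree_of_forest F) = flatten (map labels F).
Proof. by elim: F => //= T F ->. Qed.

Lemma inner_right_leaves_tree_of_forest F :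
  inner_right_leaves (tree_of_forest F) = forest_right_leaves F.
Proof. by elim: F => //= T F ->. Qed.

(** Increase along all paths is a condition on each edge, here with [a] as the
    label above the root of [t]. *)
Lemma heap_bpaths a t : all (path ltn a) (bpaths t) = heap a t.
Proof.
elim: t a => //= b l IHl r IHr a; rewrite all_map andbT -IHl -IHr -all_cat.
case: (boolP (a < b)) => //= ab.
by apply: eq_all => p /=; rewrite ab.
Qed.

(** Increase along paths makes the root label the smallest one. *)
Lemma increasing_ptreeE T :
  increasing_ptree T = heap (root_label T) (root_child T).
Proof.
case: T => a t; rewrite /increasing_ptree /= leqnn all_map -heap_bpaths /=.
rewrite andb_idl // heap_bpaths => /heap_labels.
by apply: sub_all => m; apply: ltnW.
Qed.

(** The edges off the spine belong to the trees of the forest, and the spine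
    edges compare consecutive roots. *)
Lemma heap_tree_of_forest a F :
  heap a (tree_of_forest F)
  = all increasing_ptree F && path ltn a (map root_label F).
Proof.
elim: F a => //= T F IHF a; rewrite IHF increasing_ptreeE.
by rewrite andbCA -andbA [in LHS](andbCA (a < _)).
Qed.

(** As left and inner right leaves add up to [n], having [n - l] of the latter
    means having [l] of the former; [l <= n] excludes truncated
    subtraction. *)
Lemma is_kforest_mem n k l F : 0 < n -> l <= n ->
  is_kforest n k F && (forest_right_leaves F == n - l)
  = (tree_of_forest F \in
       [seq t <- increasing_trees n | (spine t == k) && (left_leaves t == l)]).
Proof.
move=> n_gt0 l_le_n.
rewrite mem_filter mem_increasing_trees heap_tree_of_forest.
rewrite spine_tree_of_forest blabels_tree_of_forest /is_kforest.
rewrite -inner_right_leaves_tree_of_forest.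
case: (boolP (perm_eq _ _)) => [perm_F|]; last by rewrite !(andbF, andFb).
have := left_right_leaves (tree_of_forest F).
rewrite blabels_tree_of_forest (perm_size perm_F) size_iota => size_F.
have -> : (inner_right_leaves (tree_of_forest F) == n - l)
          = (left_leaves (tree_of_forest F) == l) by lia.
have -> : path ltn 0 (map root_label F) = sorted ltn (map root_label F).
  case: F perm_F {size_F} => //= T F /perm_mem/(_ (root_label T)).
  by rewrite mem_head mem_iota => /esym/andP[->].
by rewrite !andbT -!andbA andTb; congr (_ && _); rewrite andbA andbC.
Qed.

Local Open Scope ring_scope.

Theorem theorem20 :
  exists A : nat -> nat -> nat -> nat,
    (forall n k l : nat, ~~ [&& 1 <= k, k <= l & l <= n]%N -> A n k l = 0%N) /\
    A 1%N 1%N 1%N = 1%N /\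
    (forall k l : nat, (k, l) <> (1%N, 1%N) -> A 1%N k l = 0%N) /\
    (forall n k l : nat, (1 <= n)%N -> (1 <= k)%N -> (1 <= l)%N ->
       A n.+1 k l =
         (l * A n k l + (n.+1 - l) * A n k l.-1 + A n k.-1 l.-1)%N) /\
    (forall (R : comNzRingType)
            (D : {linear {mpoly R[2]} -> {mpoly R[2]}}), is_DG' D ->
       forall n : nat, (1 <= n)%N -> forall f : {mpoly R[2]},
         iter n (fun g : {mpoly R[2]} => varx R * D g) f =
         \sum_(1 <= k < n.+1) \sum_(k <= l < n.+1)
            (A n k l)%:R * (varx R ^+ l * vary R ^+ (n - l) * iter k D f)) /\
    (forall n k l : nat, (1 <= n)%N -> (l <= n)%N ->
       has_card
         (fun F : seq ptree =>
            is_kforest n k F && (forest_right_leaves F == n - l)%N)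
         (A n k l)).
Proof.
exists forest_count; split; first exact: forest_count_out.
split; first by [].
split.
  move=> k l kl; apply: forest_count_out; apply/negP => bounds.
  by apply: kl; congr (_, _); lia.
split; first exact: forest_count_rec.
split=> [R D DG n n_gt0 f|n k l n_gt0 l_le_n].
  under eq_bigr => k _ do under eq_bigr => l _ do rewrite mulr_natl.
  rewrite -(sum_by_statistics _ _
    (fun k l => varx R ^+ l * vary R ^+ (n - l) * iter k D f)) //.
  rewrite (iter_xD _ D DG); apply: eq_big_seq => t /size_increasing_tree <-.
  by rewrite -left_right_leaves addKn.
have -> : forest_count n k l = size
    [seq t <- increasing_trees n | (spine t == k) && (left_leaves t == l)].
  by rewrite size_filter; case: n n_gt0 {l_le_n}.
apply: (has_card_cancel _ _ _ _ _ _ tree_of_forestK forest_of_treeK).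
  exact/filter_uniq/uniq_increasing_trees.
by move=> F; apply: is_kforest_mem.
Qed.
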